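(* Let $\mathbf S=(\Psi,\Omega_S,Y_S,\Lambda_S)$ and $\mathbf P=(\Xi,\Omega_P,Y_P,\Lambda_P)$ be represented typed SCI computational problems with effectively indexed evaluation families $\Lambda_S=(\gamma_i)_{i\in I_S}$, $\Lambda_P=(\lambda_e)_{e\in I_P}$. The following are equivalent. (i) $\mathbf S\le_{\mathrm{TTE},\mathrm{fq}}\mathbf P$. (ii) There exist computable maps $E:\Omega_S\to\Omega_P$ and $D:Y_P\to Y_S$ such that $D(\Xi(E(x)))=\Psi(x)$ for all $x\in\Omega_S$, and such that $E$ admits a uniform finite $\Lambda_P$-trace through $\Lambda_S$. In either case, if $\Phi_E$ is a computable realizer of $E$ and $\Phi_D$ is a computable realizer of $D$, then $\widehat\Psi\le_{\mathrm{sW}}\widehat\Xi$ is witnessed by the strong Weihrauch preprocessor $\Phi_E$ and postprocessor $\Phi_D$: for every realizer $G$ of $\widehat\Xi$, the map $\Phi_D\circ G\circ\Phi_E$ is a realizer of $\widehat\Psi$.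
   Context: $\mathbb N=\{1,2,\dots\}$, $\mathbb N_0=\{0,1,2,\dots\}$. Typed SCI computational problem: a tuple $\mathbf P=(\Xi,\Omega_P,Y_P,\Lambda_P)$ with $\Omega_P$ a set of instances, $Y_P$ a metric space, $\Xi:\Omega_P\to Y_P$ the target map, and $\Lambda_P$ a family of evaluations $\lambda:\Omega_P\to V_\lambda$, each with a specified value space $V_\lambda$. It is represented if $\Omega_P$, $Y_P$ and all $V_\lambda$ are represented spaces (sets with partial surjections from Baire space). Effectively indexed means: $I_S,I_P\subseteq\mathbb N$ are sets of valid evaluation codes, procedures below are required to act correctly only on valid target-evaluation indices, and from an index the represented value space of the corresponding evaluation is known. Write $V^S_i$ for the value space of $\gamma_i$ and $V^P_e$ for that of $\lambda_e$. A realizer of a map between represented spaces is a partial map on Baire space sending each name of $x$ to a name of the image of $x$; the map is computable if it has a computable realizer. $\widehat\Psi:\Omega_S\to Y_S$, $\widehat\Xi:\Omega_P\to Y_P$ are $\Psi,\Xi$ viewed as (single-valued, total) maps between represented spaces. $\widehat\Psi\le_{\mathrm{sW}}\widehat\Xi$ (strong Weihrauch reducibility) means there are computable partial $H,K$ on Baire space such that $K\circ G\circ H$ realizes $\widehat\Psi$ for every realizer $G$ of $\widehat\Xi$; $H$ is the preprocessor and $K$ the postprocessor. Uniform finite interface trace: a computable map $E:\Omega_S\to\Omega_P$ admits a uniform finite $\Lambda_P$-trace through $\Lambda_S$ if there is a computable procedure which, given $e\in I_P$, outputs $m_e\in\mathbb N_0$, indices $i(e,1),\dots,i(e,m_e)\in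 I_S$, and an index of a computable partial map $\widehat\vartheta_e:\subseteq V^S_{i(e,1)}\times\cdots\times V^S_{i(e,m_e)}\to V^P_e$ whose domain contains $\{(\gamma_{i(e,1)}(x),\dots,\gamma_{i(e,m_e)}(x)):x\in\Omega_S\}$, such that $\lambda_e(E(x))=\widehat\vartheta_e(\gamma_{i(e,1)}(x),\dots,\gamma_{i(e,m_e)}(x))$ for all $x\in\Omega_S$. (For $m_e=0$ the product is the one-point represented space.) TTE finite-query transport: $\mathbf S\le_{\mathrm{TTE},\mathrm{fq}}\mathbf P$ if there are $E:\Omega_S\to\Omega_P$ and $D:Y_P\to Y_S$, both with computable realizers, with $D(\Xi(E(x)))=\Psi(x)$ for all $x\in\Omega_S$, and such that, uniformly in a code of each target evaluation $\lambda\in\Lambda_P$, one can compute $m_\lambda\in\mathbb N_0$, source evaluations $\gamma_{\lambda,1},\dots,\gamma_{\lambda,m_\lambda}\in\Lambda_S$ and an index of a computable partial map $\widehat\vartheta_\lambda$ from the product of their value spaces to $V_\lambda$, with domain containing the joint image of $(\gamma_{\lambda,1},\dots,\gamma_{\lambda,m_\lambda})$, such that $\lambda(E(x))=\widehat\vartheta_\lambda(\gamma_{\lambda,1}(x),\dots,\gamma_{\lambda,m_\lambda}(x))$ for all $x\in\Omega_S$. *)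

(* Defs.v *)
From mathcomp Require Import all_boot.
From Stdlib Require Cantor.
From mathcomp Require Import boolp classical_sets reals metric_structure.

Set Implicit Arguments.
Unset Strict Implicit.
Unset Printing Implicit Defensive.

(* Set-theoretic partial maps, given by their graphs; no decidability of the
   domain is involved. *)
Record pfun (A B : Type) := PFun {
  graph :> A -> B -> Prop;
  graph_fun : forall x y z, graph x y -> graph x z -> y = z
}.

Definition in_dom A B (f : pfun A B) (x : A) : Prop := exists y, f x y.

Lemma pfun_of_fun A B (f : A -> B) x y z : y = f x -> z = f x -> y = z.
Proof. by move=> -> ->. Qed.

Definition pfun_of A B (f : A -> B) : pfun A B := PFun (@pfun_of_fun A B f).

Definition comp_graph A B C (g : pfun B C) (f : pfun A B) (x : A) (z : C) :=
  exists2 y, f x y & g y z.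

Lemma comp_graph_fun A B C (g : pfun B C) (f : pfun A B) x z1 z2 :
  comp_graph g f x z1 -> comp_graph g f x z2 -> z1 = z2.
Proof.
move=> [y1 fy1 gz1] [y2 fy2 gz2].
by move: gz2; rewrite -(graph_fun fy1 fy2); exact: graph_fun gz1.
Qed.

Definition pcompose A B C (g : pfun B C) (f : pfun A B) : pfun A C :=
  PFun (@comp_graph_fun A B C g f).

Definition Baire := nat -> nat.

(* The Cantor pairing bijection. *)
Definition npair (x y : nat) : nat := Cantor.to_nat (x, y).
Definition nfst (n : nat) : nat := (Cantor.of_nat n).1.
Definition nsnd (n : nat) : nat := (Cantor.of_nat n).2.

Lemma npairK x y : Cantor.of_nat (npair x y) = (x, y).
Proof. exact: Cantor.cancel_of_to. Qed.

Lemma npair_inj x1 y1 x2 y2 : npair x1 y1 = npair x2 y2 -> x1 = x2 /\ y1 = y2.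
Proof. by move/(congr1 Cantor.of_nat); rewrite !npairK => -[-> ->]. Qed.

(* Unary oracle programs; several arguments are passed through [npair]. *)
Inductive prog :=
| Zero | Succ | Fst | Snd | Oracle
| Pair of prog & prog
| Comp of prog & prog
| Prec of prog & prog
| Mu of prog.

Fixpoint prec_graph (f g : nat -> nat -> Prop) (x n y : nat) : Prop :=
  if n is n'.+1
  then exists2 z, prec_graph f g x n' z & g (npair x (npair n' z)) y
  else f x y.

(* [ev p c x y]: on input [x] and with oracle [p], the program [c] halts with
   output [y]. *)
Fixpoint ev (p : Baire) (c : prog) (x y : nat) : Prop :=
  match c with
  | Zero => y = 0
  | Succ => y = x.+1
  | Fst => y = nfst x
  | Snd => y = nsnd x
  | Oracle => y = p x
  | Pair f g => exists a b, [/\ ev p f x a, ev p g x b & y = npair a b]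
  | Comp f g => exists2 a, ev p g x a & ev p f a y
  | Prec f g => prec_graph (ev p f) (ev p g) (nfst x) (nsnd x) y
  | Mu f => ev p f (npair x y) 0 /\
            forall m, m < y -> exists k, ev p f (npair x m) k.+1
  end.

Lemma ev_fun p c x y z : ev p c x y -> ev p c x z -> y = z.
Proof.
elim: c x y z => [||||| f IHf g IHg | f IHf g IHg | f IHf g IHg | f IHf] x y z
  /=; try by move=> -> ->.
- move=> [a [b [fa gb ->]]] [a' [b' [fa' gb' ->]]].
  by rewrite (IHf _ _ _ fa fa') (IHg _ _ _ gb gb').
- move=> [a ga fa] [a' ga']; rewrite -(IHg _ _ _ ga ga'); exact: IHf.
- elim: (nsnd x) y z => [|n IHn] y z /=; first exact: IHf.
  move=> [a ra ga] [a' ra']; rewrite -(IHn _ _ ra ra'); exact: IHg.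
- move=> [fy miny] [fz minz]; case: (ltngtP y z) => // [/minz|/miny] [k fk].
  + by have := IHf _ _ _ fy fk.
  + by have := IHf _ _ _ fz fk.
Qed.

Fixpoint godel (c : prog) : nat :=
  match c with
  | Zero => npair 0 0
  | Succ => npair 1 0
  | Fst => npair 2 0
  | Snd => npair 3 0
  | Oracle => npair 4 0
  | Pair f g => npair 5 (npair (godel f) (godel g))
  | Comp f g => npair 6 (npair (godel f) (godel g))
  | Prec f g => npair 7 (npair (godel f) (godel g))
  | Mu f => npair 8 (godel f)
  end.

Lemma godel_inj : injective godel.
Proof.
elim=> [||||| f IHf g IHg | f IHf g IHg | f IHf g IHg | f IHf]
  [||||| f' g' | f' g' | f' g' | f'] /= /npair_inj[] //.
all: try by move=> _ /npair_inj[/IHf-> /IHg->].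
by move=> _ /IHf->.
Qed.

(* A computable procedure on natural numbers is a program run without help from
   the oracle: the zero oracle is itself computable. *)
Definition computes (c : prog) (x y : nat) : Prop := ev (fun=> 0) c x y.

Definition phi_graph (t : nat) (p q : Baire) : Prop :=
  exists2 c, godel c = t & forall n, ev p c n (q n).

Lemma phi_graph_fun t p q q' : phi_graph t p q -> phi_graph t p q' -> q = q'.
Proof.
move=> [c <- cq] [c' /godel_inj -> cq'].
by apply: funext => n; exact: ev_fun (cq n) (cq' n).
Qed.

(* [phi t] is the partial map on Baire space with index [t], on its maximal
   domain; it is nowhere defined if [t] is not the code of a program. *)
Definition phi (t : nat) : pfun Baire Baire := PFun (@phi_graph_fun t).

Definition computable (F : pfun Baire Baire) : Prop :=
  exists t, forall p q, F p q -> phi t p q.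

Record representation (X : Type) := Representation {
  names :> pfun Baire X;
  names_surj : forall x, exists p, names p x
}.

Definition realizes X Y (dX : representation X) (dY : representation Y)
    (F : pfun Baire Baire) (f : pfun X Y) : Prop :=
  forall p x y, dX p x -> f x y -> exists2 q, F p q & dY q y.

Definition computable_map X Y (dX : representation X) (dY : representation Y)
    (f : X -> Y) : Prop :=
  exists2 F, computable F & realizes dX dY F (pfun_of f).

(* [p] names a tuple when each section [p <j, _>] names its [j]-th component;
   for [m = 0] this is the one-point space. *)
Section ProductRepresentation.
Variables (m : nat) (X : 'I_m -> Type) (d : forall j, representation (X j)).

Definition prod_graph (p : Baire) (x : forall j, X j) : Prop :=
  forall j : 'I_m, d j (fun n => p (npair j n)) (x j).

Lemma prod_graph_fun p x y : prod_graph p x -> prod_graph p y -> x = y.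
Proof.
move=> px py; apply: functional_extensionality_dep => j.
exact: graph_fun (px j) (py j).
Qed.

Definition prod_names : pfun Baire (forall j, X j) := PFun prod_graph_fun.

Lemma prod_names_surj x : exists p, prod_names p x.
Proof.
have [q qx] := fin_all_exists (fun j => names_surj (d j) (x j)).
exists (fun k => if insub (nfst k) is Some j then q j (nsnd k) else 0) => j /=.
suff -> : (fun n => if insub (nfst (npair j n)) is Some j0
                    then q j0 (nsnd (npair j n)) else 0) = q j by exact: qx.
by apply: funext => n; rewrite /nfst /nsnd npairK /= valK.
Qed.

Definition prod_representation : representation (forall j, X j) :=
  Representation prod_names_surj.

End ProductRepresentation.

(* [H] is the preprocessor and [K] the postprocessor. *)
Definition sW_witness X Y Z W
    (dX : representation X) (dY : representation Y)
    (dZ : representation Z) (dW : representation W)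
    (H K : pfun Baire Baire) (f : pfun X Y) (g : pfun Z W) : Prop :=
  [/\ computable H, computable K &
      forall G, realizes dZ dW G g ->
        realizes dX dY (pcompose K (pcompose G H)) f].

Definition sW_reducible X Y Z W
    (dX : representation X) (dY : representation Y)
    (dZ : representation Z) (dW : representation W)
    (f : pfun X Y) (g : pfun Z W) : Prop :=
  exists H K, sW_witness dX dY dZ dW H K f g.

(* The evaluation family is indexed by the set of valid codes, a set of
   positive integers. *)
Record sci_problem (R : realType) := SCIProblem {
  inst : Type;
  out : metricType R;
  target : inst -> out;
  codes : set nat;
  codes_gt0 : forall i, codes i -> 0 < i;
  value : codes -> Type;
  eval : forall i : codes, inst -> value i
}.

Record represented_problem (R : realType) := RepresentedProblem {
  problem :> sci_problem R;
  rep_inst : representation (inst problem);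
  rep_out : representation (out problem);
  rep_value : forall i : codes problem, representation (value i)
}.

Section Transport.
Variables (R : realType) (S P : represented_problem R).

Definition joint_eval m (i : 'I_m -> codes S) (x : inst S) :
  forall j, value (i j) := fun j => eval (i j) x.

(* [t] is an index of a computable partial map that recovers the evaluation
   [e] of [E x] from the evaluations [i 0], ..., [i (m - 1)] of [x]. *)
Definition evaluates_through (E : inst S -> inst P) (e : codes P)
    m (i : 'I_m -> codes S) (t : nat) : Prop :=
  exists theta : pfun (forall j, value (i j)) (value e),
    [/\ realizes (prod_representation (fun j => rep_value (i j)))
          (rep_value e) (phi t) theta,
        forall x, in_dom theta (joint_eval i x) &
        forall x, theta (joint_eval i x) (eval e (E x))].

Definition trace_code m (i : 'I_m -> codes S) (t : nat) : nat :=
  CodeSeq.code [:: m, t & [seq val (i j) | j <- enum 'I_m]].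

Definition uniform_finite_trace (E : inst S -> inst P) : Prop :=
  exists c : prog, forall e : codes P,
    exists m (i : 'I_m -> codes S) (t : nat),
      computes c (val e) (trace_code i t) /\ evaluates_through E e i t.

Definition intertwines (E : inst S -> inst P) (D : out P -> out S) : Prop :=
  forall x, D (target (E x)) = target x.

Definition traced_pair (E : inst S -> inst P) (D : out P -> out S) : Prop :=
  [/\ computable_map (rep_inst S) (rep_inst P) E,
      computable_map (rep_out P) (rep_out S) D,
      intertwines E D &
      uniform_finite_trace E].

(* The query data are given here as functions of the target code, which are
   jointly computable. *)
Definition TTE_fq_pair (E : inst S -> inst P) (D : out P -> out S) : Prop :=
  [/\ exists2 F, computable F &
        realizes (rep_inst S) (rep_inst P) F (pfun_of E),
      exists2 F, computable F &
        realizes (rep_out P) (rep_out S) F (pfun_of D),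
      intertwines E D &
      exists (m : codes P -> nat) (i : forall e, 'I_(m e) -> codes S)
             (t : codes P -> nat),
        (exists c, forall e, computes c (val e) (trace_code (i e) (t e))) /\
        (forall e, evaluates_through E e (i e) (t e))].

Definition TTE_fq_reducible : Prop := exists E D, TTE_fq_pair E D.

End Transport.

(* Main.v *)
Require Import Defs.
From mathcomp Require Import all_boot.
From mathcomp Require Import boolp classical_sets reals metric_structure.

Set Implicit Arguments.
Unset Strict Implicit.

(** Both conditions ask for the same maps [E] and [D], and they package the query
    data differently: the transport asks for functions sending each target code
    to its number of queries, their codes and an index of the recovering map,
    while the trace asserts, code by code, that such data are what one fixed
    program outputs.  Functions give pointwise existence at once; conversely,
    choosing data for each code yields functions, and these are automatically
    jointly computable because the choice is made among data that the single
    program already outputs ([TTE_fq_pairP]).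

    The reduction is the functoriality of realizers: composites of realizers
    realize composites of maps ([realizes_comp]).  Hence, for any realizer [G] of
    the target map of [P], the composite of [PhiD], [G] and [PhiE] realizes the
    composite of [D], that target map and [E], which is the target map of [S]
    ([intertwines_sW_witness]).  Applied to the
    realizers that come with [E] and [D], this gives the strong Weihrauch
    reducibility. *)

Lemma realizes_comp X Y Z (dX : representation X) (dY : representation Y)
    (dZ : representation Z) (F G : pfun Baire Baire)
    (f : pfun X Y) (g : pfun Y Z) :
  realizes dX dY F f -> realizes dY dZ G g ->
  realizes dX dZ (pcompose G F) (pcompose g f).
Proof.
move=> Ff Gg p x z px [y fxy gyz].
have [q Fpq qy] := Ff p x y px fxy.
have [r Gqr rz] := Gg q y z qy gyz.
by exists r => //; exists q.
Qed.

(** A realizer is tested only on the graph of the map, so it also realizes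
    every restriction; this turns an equation between maps that holds pointwise
    into a transfer of realizers. *)
Lemma realizes_sub X Y (dX : representation X) (dY : representation Y)
    (F : pfun Baire Baire) (f g : pfun X Y) :
  (forall x y, g x y -> f x y) -> realizes dX dY F f -> realizes dX dY F g.
Proof. by move=> gf Ff p x y px /gf; exact: Ff. Qed.

Lemma intertwines_sW_witness (R : realType) (S P : represented_problem R)
    (E : inst S -> inst P) (D : out P -> out S) (PhiE PhiD : pfun Baire Baire) :
  intertwines E D ->
  computable PhiE -> realizes (rep_inst S) (rep_inst P) PhiE (pfun_of E) ->
  computable PhiD -> realizes (rep_out P) (rep_out S) PhiD (pfun_of D) ->
  sW_witness (rep_inst S) (rep_out S) (rep_inst P) (rep_out P)
    PhiE PhiD (pfun_of (@target R S)) (pfun_of (@target R P)).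
Proof.
move=> DE cE rE cD rD; split=> // G rG.
have rGE := realizes_comp rE rG; apply: realizes_sub (realizes_comp rGE rD).
move=> x _ ->; exists (target (E x)); last by rewrite /= DE.
by exists (E x).
Qed.

(** The nontrivial direction chooses, for each target code, data output by the
    tracing program; joint computability is then part of what was chosen. *)
Lemma TTE_fq_pairP (R : realType) (S P : represented_problem R)
    (E : inst S -> inst P) (D : out P -> out S) :
  TTE_fq_pair E D <-> traced_pair E D.
Proof.
split=> [[cE cD DE [m [i [t [[c c_it] th]]]]]|[cE cD DE [c trace]]].
  by split=> //; exists c => e; exists (m e), (i e), (t e).
split=> //.
(* The type of the queries depends on their number, so each code gets its data
   as a single dependent pair before these are split into three functions. *)
have /choice[q qP] : forall e : codes P,
    exists q : {m : nat & (('I_m -> codes S) * nat)%type},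
      computes c (val e) (trace_code (projT2 q).1 (projT2 q).2) /\
      evaluates_through E e (projT2 q).1 (projT2 q).2.
  by move=> e; have [m [i [t it]]] := trace e; exists (existT _ m (i, t)).
exists (fun e => projT1 (q e)), (fun e => (projT2 (q e)).1),
  (fun e => (projT2 (q e)).2).
by split=> [|e]; [exists c => e|]; have [] := qP e.
Qed.

Unset Implicit Arguments.
Set Strict Implicit.

Theorem theorem5p1 (R : realType) (S P : represented_problem R) :
  (TTE_fq_reducible S P <->
   exists (E : inst S -> inst P) (D : out P -> out S),
     [/\ computable_map (rep_inst S) (rep_inst P) E,
         computable_map (rep_out P) (rep_out S) D,
         forall x, D (target (E x)) = target x &
         uniform_finite_trace E])
  /\
  (forall (E : inst S -> inst P) (D : out P -> out S),
     TTE_fq_pair E D \/ traced_pair E D ->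
     sW_reducible (rep_inst S) (rep_out S) (rep_inst P) (rep_out P)
       (pfun_of (@target R S)) (pfun_of (@target R P))
     /\
     forall PhiE PhiD : pfun Baire Baire,
       computable PhiE ->
       realizes (rep_inst S) (rep_inst P) PhiE (pfun_of E) ->
       computable PhiD ->
       realizes (rep_out P) (rep_out S) PhiD (pfun_of D) ->
       sW_witness (rep_inst S) (rep_out S) (rep_inst P) (rep_out P)
         PhiE PhiD (pfun_of (@target R S)) (pfun_of (@target R P))).
Proof.
split; first by split=> -[E [D /TTE_fq_pairP ED]]; exists E, D.
move=> E D ED.
have [[FE cE rE] [FD cD rD] DE _] : traced_pair E D.
  by case: ED => // /TTE_fq_pairP.
split; last by move=> *; exact: (intertwines_sW_witness DE).
by exists FE, FD; exact: (intertwines_sW_witness DE).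
Qed.
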